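(* Let $\lambda\in\mathbb{R}$ and consider, for $\delta>0$, the initial value problem for a function $u=u(r)$ $$\left(\frac{u'(r)^2}{1+u'(r)^2}\right)'=\frac{2r}{\sqrt{1+u'(r)^2}}+2\lambda r \quad\text{in } (0,\delta),\qquad u(0)=0,\quad u'(0)=0.$$ Its solvability for some $\delta>0$ is as follows: (1) If $\lambda<-1$, then there are no solutions (for any $\delta>0$). (2) If $\lambda=-1$, the solution is $u(r)=0$. (3) If $\lambda>-1$, there is $R>0$ such that the initial value problem has a solution in the interval $[0,R]$.
   Context: A solution on an interval $[0,R]$ (or $[0,\delta)$) is a real function $u$ that is $C^1$ up to and including $r=0$, $C^2$ for $r>0$ in the interval, satisfies the differential equation for $r>0$, and satisfies $u(0)=u'(0)=0$. (The equation is the condition that the rotational surface $(r,t)\mapsto(r\cos t,r\sin t,u(r))$, meeting the rotation axis orthogonally at the origin, has Gauss curvature $K=\langle N,(0,0,1)\rangle+\lambda$.) *)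

(* Defs.v *)
From Stdlib Require Import Reals.
Open Scope R_scope.

(* Derivatives and continuity are taken relative to [D], hence one-sided at an
   endpoint of an interval that belongs to it; values off [D] are irrelevant. *)
Definition C1_on (D : R -> Prop) (f f' : R -> R) : Prop :=
  forall x : R, D x -> D_in f f' D x /\ continue_in f' D x.

Definition Ico (a b : R) : R -> Prop := fun x => a <= x < b.
Definition Icc (a b : R) : R -> Prop := fun x => a <= x <= b.
Definition positive_part (I : R -> Prop) : R -> Prop := fun r => I r /\ 0 < r.

(* [I] is meant to be an interval [0, R] or [0, delta) of positive length, so
   that [u'] and [u''] are uniquely determined by [u] where they are used. *)
Definition is_solution (lambda : R) (I : R -> Prop) (u : R -> R) : Prop :=
  exists u' u'' : R -> R,
    C1_on I u u' /\
    C1_on (positive_part I) u' u'' /\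
    (forall r : R, positive_part I r ->
       D_in (fun s => (u' s) ^ 2 / (1 + (u' s) ^ 2))
            (fun s => 2 * s / sqrt (1 + (u' s) ^ 2) + 2 * lambda * s)
            (positive_part I) r) /\
    u 0 = 0 /\ u' 0 = 0.

(* Main.v *)
Require Import Defs.
From Stdlib Require Import Reals.
From Stdlib Require Import Lra Ranalysis5.
From Coquelicot Require Import Coquelicot.
Open Scope R_scope.

(** Put [p = u'], [w = p ^ 2 / (1 + p ^ 2)] and [q = 1 / sqrt (1 + p ^ 2)], so
    that [w = 1 - q ^ 2] and [0 < q <= 1]. The equation reads
    [w' = 2 * r * (q + lambda)].

    If [lambda <= -1], the right-hand side is nonpositive because [q <= 1]. As
    [w] starts from [0] it can only decrease, yet [w >= 0]; hence [w = 0] and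
    [p = 0] ([solution_slope_zero]). Integrating, [u = 0]; and the equation at
    [p = 0] is [0 = 2 * r * (1 + lambda)], which excludes [lambda < -1].

    If [lambda > -1], the equation becomes [q * q' = - r * (q + lambda)], which
    is autonomous in the variable [s = r ^ 2 / 2]. With [t = 1 - q] it is
    [dt/ds = (1 + lambda - t) / (1 - t)], [t 0 = 0], and separating variables
    gives
    [t + lambda * ln (1 + lambda - t) - lambda * ln (1 + lambda) = s].
    The left-hand side has derivative [1 / (1 + lambda)] at [t = 0], which is
    positive, so it can be inverted near [0] ([local_inverse]). This gives [q]
    on both sides of [r = 0] ([angle_function_exists]), and
    [u r] is the integral of [sqrt (1 / q ^ 2 - 1)] from [0] to [r]. The square
    root can be differentiated where [q < 1], that is for [r > 0]; at [r = 0],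
    where the problem asks only that the slope be continuous, continuity of the
    square root is enough ([solution_exists]). *)

(** * Relative and two-sided derivatives *)

(** This lets a function be replaced by a simpler expression [g] that agrees with it
    on [D] only. *)
Lemma D_in_of_is_derive (D : R -> Prop) (f g d : R -> R) (x : R) :
  D x -> (forall y, D y -> f y = g y) -> is_derive g x (d x) -> D_in f d D x.
Proof.
  intros Dx fg dg.
  apply is_derive_Reals, (derivable_pt_lim_D_in g d x) in dg.
  intros eps Heps; destruct (dg eps Heps) as [alp [Halp H]].
  exists alp; split; [exact Halp|].
  intros y [[Dy nxy] Hy].
  rewrite (fg y Dy), (fg x Dx).
  apply H; split; [split; [exact I|exact nxy]|exact Hy].
Qed.

Lemma continue_in_of_continuous (D : R -> Prop) (f : R -> R) (x : R) :
  continuous f x -> continue_in f D x.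
Proof.
  intros Hf; apply continuity_pt_filterlim in Hf.
  intros eps Heps; destruct (Hf eps Heps) as [alp [Halp H]].
  exists alp; split; [exact Halp|].
  intros y [[_ nxy] Hy]; apply H; split; [split; [exact I|exact nxy]|exact Hy].
Qed.

Lemma is_derive_of_D_in_interior (D : R -> Prop) (f d : R -> R) (x : R) :
  locally x D -> D_in f d D x -> is_derive f x (d x).
Proof.
  intros [e De] HD; apply is_derive_Reals, (derivable_pt_lim_D_in f d x).
  intros eps Heps; destruct (HD eps Heps) as [alp [Halp H]].
  exists (Rmin alp e); split; [apply Rmin_pos; [exact Halp|apply cond_pos]|].
  intros y [[_ nxy] Hy]; apply H; split.
  - split; [|exact nxy].
    apply De; eapply Rlt_le_trans; [exact Hy|apply Rmin_r].
  - eapply Rlt_le_trans; [exact Hy|apply Rmin_l].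
Qed.

Lemma locally_positive_Ico (delta r : R) :
  positive_part (Ico 0 delta) r -> locally r (positive_part (Ico 0 delta)).
Proof.
  intros [[_ Hd] H0].
  assert (L := open_and (fun x => 0 < x) (fun x => x < delta)
           (open_gt 0) (open_lt delta) r (conj H0 Hd)).
  revert L; apply filter_imp; intros x [H1 H2]; unfold positive_part, Ico; lra.
Qed.

(** One-sided continuity at [0] is used instead of differentiability there: the
    mean value theorem applies on [[e, r]] with [e > 0], and [f e] is close to
    [f 0]. *)
Lemma nonpos_derivative_le_initial (delta : R) (f f' : R -> R) :
  continue_in f (Ico 0 delta) 0 ->
  (forall r, positive_part (Ico 0 delta) r ->
     D_in f f' (positive_part (Ico 0 delta)) r /\ f' r <= 0) ->
  forall r, Ico 0 delta r -> f r <= f 0.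
Proof.
  intros Cf Df r [Hr0 Hrd].
  destruct (Rle_lt_dec (f r) (f 0)) as [|Hlt]; [assumption|exfalso].
  destruct (Req_dec r 0) as [->|nr]; [lra|].
  destruct (Cf (f r - f 0)) as [alp [Halp H]]; [lra|].
  set (e := Rmin (alp / 2) (r / 2)).
  assert (He : 0 < e) by (apply Rmin_pos; lra).
  assert (He1 := Rmin_l (alp / 2) (r / 2) : e <= _).
  assert (He2 := Rmin_r (alp / 2) (r / 2) : e <= _).
  assert (Hfe : f e < f r).
  { specialize (H e); simpl in H; unfold Rdist in H.
    assert (Hd : Rabs (f e - f 0) < f r - f 0).
    { apply H; split; [split; [unfold Ico; lra|lra]|].
      rewrite Rabs_pos_eq; lra. }
    apply Rabs_def2 in Hd; lra. }
  destruct (MVT_cor2 f f' e r) as [c [Hc Hcr]]; [lra| |].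
  - intros c Hc; apply is_derive_Reals.
    assert (Pc : positive_part (Ico 0 delta) c)
      by (unfold positive_part, Ico; lra).
    exact (is_derive_of_D_in_interior _ _ _ _
             (locally_positive_Ico _ _ Pc) (proj1 (Df c Pc))).
  - assert (Hf' := proj2 (Df c ltac:(unfold positive_part, Ico; lra))).
    assert (0 <= - f' c * (r - e)) by (apply Rmult_le_pos; lra); lra.
Qed.

(** * The case where lambda is at most -1 *)

Lemma inv_sqrt_one_plus_sqr_le_1 (p : R) : 0 < / sqrt (1 + p ^ 2) <= 1.
Proof.
  assert (H : 1 <= sqrt (1 + p ^ 2)).
  { rewrite <- sqrt_1 at 1; apply sqrt_le_1_alt; nra. }
  split; [apply Rinv_0_lt_compat; lra|].
  apply Rle_trans with (/ 1); [apply Rinv_le_contravar|]; lra.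
Qed.

Lemma continuous_slope_quotient (x : R) :
  continuous (fun p => p ^ 2 / (1 + p ^ 2)) x.
Proof.
  apply (ex_derive_continuous (fun p => p ^ 2 / (1 + p ^ 2))).
  auto_derive; nra.
Qed.

Lemma continue_in_comp_continuous (D : R -> Prop) (f g : R -> R) (x : R) :
  continue_in f D x -> continuous g (f x) -> continue_in (fun y => g (f y)) D x.
Proof.
  intros Cf Cg; apply continuity_pt_filterlim in Cg.
  intros eps Heps; destruct (Cg eps Heps) as [b [Hb Hg]].
  destruct (Cf b Hb) as [a [Ha Hf]].
  exists a; split; [exact Ha|]; intros y Hy.
  destruct (Req_dec (f x) (f y)) as [E|nE].
  - simpl; unfold Rdist; rewrite E, Rminus_diag, Rabs_R0; exact Heps.
  - apply Hg; split; [split; [exact I|exact nE]|exact (Hf y Hy)].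
Qed.

(** Here [w = p ^ 2 / (1 + p ^ 2)] is squeezed between [0] and its initial value
    [0], since [w' = 2 * r * (q + lambda)] with [q <= 1 <= - lambda]. *)
Lemma solution_slope_zero (lambda delta : R) (p : R -> R) :
  lambda <= -1 ->
  continue_in p (Ico 0 delta) 0 ->
  (forall r, positive_part (Ico 0 delta) r ->
     D_in (fun s => (p s) ^ 2 / (1 + (p s) ^ 2))
          (fun s => 2 * s / sqrt (1 + (p s) ^ 2) + 2 * lambda * s)
          (positive_part (Ico 0 delta)) r) ->
  p 0 = 0 ->
  forall r, Ico 0 delta r -> p r = 0.
Proof.
  intros Hl Cp Dp p0 r Hr.
  assert (Hle : p r ^ 2 / (1 + p r ^ 2) <= 0).
  { replace 0 with (p 0 ^ 2 / (1 + p 0 ^ 2)) by (rewrite p0; field).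
    apply (nonpos_derivative_le_initial delta
             (fun s => p s ^ 2 / (1 + p s ^ 2))
             (fun s => 2 * s / sqrt (1 + p s ^ 2) + 2 * lambda * s)
             (continue_in_comp_continuous _ _ _ _ Cp
                (continuous_slope_quotient (p 0)))); [|exact Hr].
    intros s Hs; split; [exact (Dp s Hs)|].
    destruct Hs as [_ Hs]; assert (Hq := inv_sqrt_one_plus_sqr_le_1 (p s)).
    unfold Rdiv; nra. }
  assert (Hp : 0 < 1 + p r ^ 2) by nra.
  assert (Hsq : p r ^ 2 <= 0).
  { replace (p r ^ 2) with (p r ^ 2 / (1 + p r ^ 2) * (1 + p r ^ 2))
      by (field; lra).
    nra. }
  nra.
Qed.

(** The slope vanishes, so the left-hand side of the equation is the derivative
    of [0], while the right-hand side is [2 * r * (1 + lambda) < 0]. *)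
Lemma no_solution (lambda delta : R) (u : R -> R) :
  lambda < -1 -> 0 < delta -> ~ is_solution lambda (Ico 0 delta) u.
Proof.
  intros Hl Hd [p [p' [Hu [_ [Hw [_ p0]]]]]].
  assert (Hp := solution_slope_zero lambda delta p (Rlt_le _ _ Hl)
    (proj2 (Hu 0 ltac:(unfold Ico; lra))) Hw p0).
  set (r := delta / 2).
  assert (Hr : positive_part (Ico 0 delta) r)
    by (unfold positive_part, Ico, r; lra).
  assert (L := locally_positive_Ico _ _ Hr).
  assert (D1 := is_derive_of_D_in_interior _ _ _ _ L (Hw r Hr)).
  assert (D0 : is_derive (fun _ : R => 0) r
                 (2 * r / sqrt (1 + p r ^ 2) + 2 * lambda * r)).
  { revert D1; apply is_derive_ext_loc.
    revert L; apply filter_imp; intros s [Hs _]; rewrite (Hp s Hs).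
    change (0 ^ 2 / (1 + 0 ^ 2) = 0); field. }
  apply is_derive_unique in D0; rewrite Derive_const in D0.
  rewrite (Hp r (proj1 Hr)) in D0.
  replace (1 + 0 ^ 2) with 1 in D0 by ring.
  rewrite sqrt_1 in D0; destruct Hr as [_ Hr]; nra.
Qed.

(** The slope vanishes; comparing both [u] and [- u] with their initial values
    avoids a separate constancy theorem for one-sided derivatives. *)
Lemma solution_zero (delta : R) (u : R -> R) :
  is_solution (-1) (Ico 0 delta) u -> forall r, Ico 0 delta r -> u r = 0.
Proof.
  intros [p [p' [Hu [_ [Hw [u0 p0]]]]]] r Hr.
  assert (H0 : Ico 0 delta 0) by (unfold Ico in *; lra).
  assert (Hp := solution_slope_zero (-1) delta p (Rle_refl _)
    (proj2 (Hu 0 H0)) Hw p0).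
  assert (Cu := cont_deriv _ _ _ _ (proj1 (Hu 0 H0))).
  assert (Du : forall s, positive_part (Ico 0 delta) s ->
                 D_in u p (positive_part (Ico 0 delta)) s).
  { intros s [Hs _]; apply (D_in_imp u p (Ico 0 delta));
      [intros x [Hx _]; exact Hx|exact (proj1 (Hu s Hs))]. }
  assert (Dn : forall s, positive_part (Ico 0 delta) s ->
                 D_in (fun s => - u s) (fun s => - p s)
                   (positive_part (Ico 0 delta)) s).
  { intros s Hs; apply Dopp, Du, Hs. }
  assert (U1 : u r <= u 0).
  { apply (nonpos_derivative_le_initial delta u p Cu); [|exact Hr].
    intros s Hs; split; [exact (Du s Hs)|rewrite (Hp s (proj1 Hs)); lra]. }
  assert (U2 : - u r <= - u 0).
  { apply (nonpos_derivative_le_initial delta (fun s => - u s)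
             (fun s => - p s)); [| |exact Hr].
    - apply (limit_Ropp u); exact Cu.
    - intros s Hs; split; [exact (Dn s Hs)|rewrite (Hp s (proj1 Hs)); lra]. }
  lra.
Qed.

Lemma zero_is_solution (delta : R) (u : R -> R) :
  0 < delta -> (forall r, Ico 0 delta r -> u r = 0) ->
  is_solution (-1) (Ico 0 delta) u.
Proof.
  intros Hd Hu.
  exists (fun _ => 0), (fun _ => 0).
  assert (C0 : forall D x, continue_in (fun _ => 0) D x)
    by (intros D x; apply continue_in_of_continuous, continuous_const).
  split; [|split; [|split; [|split; [|reflexivity]]]].
  - intros r Hr; split; [|apply C0].
    apply (D_in_of_is_derive _ _ (fun _ => 0)); [exact Hr|exact Hu|].
    apply (is_derive_const 0).
  - intros r Hr; split; [apply Dconst|apply C0].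
  - intros r Hr.
    apply (D_in_of_is_derive _ _ (fun _ => 0));
      [exact Hr|intros s _; field|].
    replace (1 + 0 ^ 2) with 1 by ring; rewrite sqrt_1.
    replace (2 * r / 1 + 2 * -1 * r) with 0 by field.
    apply (is_derive_const 0).
  - apply Hu; unfold Ico; lra.
Qed.

(** * Separation of variables when lambda exceeds -1 *)

(** The inverse is built on the image of the whole interval [[-a, a]]; its
    derivative comes from the inverse function theorem of the reals. *)
Lemma local_inverse (f f' : R -> R) (a : R) :
  0 < a -> f 0 = 0 ->
  (forall t, - a <= t <= a -> is_derive f t (f' t) /\ 0 < f' t) ->
  exists (eta : R) (g : R -> R), 0 < eta /\ g 0 = 0 /\
    forall s, - eta < s < eta -> - a <= g s <= a /\ is_derive g s (/ f' (g s)).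
Proof.
  intros Ha f0 Df.
  assert (Cf : forall t, - a <= t <= a -> continuity_pt f t).
  { intros t Ht; apply continuity_pt_filterlim, (ex_derive_continuous f).
    exists (f' t); apply Df, Ht. }
  assert (Inc : forall x y, - a <= x -> x < y -> y <= a -> f x < f y).
  { intros x y Hx Hxy Hy.
    destruct (MVT_cor2 f f' x y Hxy) as [c [Hc Hcr]].
    - intros c Hc; apply is_derive_Reals, Df; lra.
    - assert (0 < f' c * (y - x)); [|lra].
      apply Rmult_lt_0_compat; [apply Df|]; lra. }
  assert (G : forall y, {x | f (- a) <= y <= f a -> - a <= x <= a /\ f x = y}).
  { intros y.
    destruct (Rle_dec (f (- a)) y) as [H1|H1]; [|exists 0; lra].
    destruct (Rle_dec y (f a)) as [H2|H2]; [|exists 0; lra].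
    destruct (f_interv_is_interv f (- a) a y ltac:(lra) (conj H1 H2) Cf)
      as [x Hx].
    exists x; intros _; exact Hx. }
  set (g := fun y => proj1_sig (G y)).
  assert (Hg : forall y, f (- a) <= y <= f a -> - a <= g y <= a /\ f (g y) = y)
    by (intros y; exact (proj2_sig (G y))).
  assert (Hm : f (- a) < 0) by (rewrite <- f0; apply Inc; lra).
  assert (Hp : 0 < f a) by (rewrite <- f0; apply Inc; lra).
  exists (Rmin (- f (- a)) (f a)), g.
  split; [apply Rmin_pos; lra|split].
  - destruct (Hg 0 ltac:(lra)) as [H1 H2].
    destruct (Rtotal_order (g 0) 0) as [H|[H|H]]; [|exact H|].
    + assert (f (g 0) < f 0) by (apply Inc; lra); lra.
    + assert (f 0 < f (g 0)) by (apply Inc; lra); lra.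
  - intros s Hs.
    assert (M1 := Rmin_l (- f (- a)) (f a)).
    assert (M2 := Rmin_r (- f (- a)) (f a)).
    assert (Hs' : f (- a) < s < f a) by lra.
    destruct (Hg s ltac:(lra)) as [Hgs _].
    split; [exact Hgs|].
    assert (Cg : continuity_pt g s).
    { apply (continuity_pt_recip_interv f g (- a) a ltac:(lra) Inc);
        [| |exact Cf|exact Hs'].
      - intros x H1 H2; exact (proj2 (Hg x (conj H1 H2))).
      - intros x H1 H2; exact (proj1 (Hg x (conj H1 H2))). }
    assert (ga : g (f a) = a).
    { destruct (Hg (f a) ltac:(lra)) as [H1 H2].
      destruct (Req_dec (g (f a)) a) as [E|nE]; [exact E|].
      assert (f (g (f a)) < f a) by (apply Inc; lra); lra. }
    assert (gma : g (f (- a)) = - a).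
    { destruct (Hg (f (- a)) ltac:(lra)) as [H1 H2].
      destruct (Req_dec (g (f (- a))) (- a)) as [E|nE]; [exact E|].
      assert (f (- a) < f (g (f (- a)))) by (apply Inc; lra); lra. }
    assert (Prf : forall t, g (f (- a)) <= t <= g (f a) -> derivable_pt f t).
    { rewrite ga, gma; intros t Ht; exists (f' t).
      apply is_derive_Reals, Df, Ht. }
    assert (Prg : g (f (- a)) <= g s <= g (f a)) by (rewrite ga, gma; exact Hgs).
    assert (E : derive_pt f (g s) (Prf (g s) Prg) = f' (g s)).
    { apply derive_pt_eq_0, is_derive_Reals, Df, Hgs. }
    apply is_derive_Reals.
    assert (L := derivable_pt_lim_recip_interv f g (f (- a)) (f a) s Prf Cg
                   ltac:(lra) Hs' Prg).
    rewrite E in L; unfold Rdiv in L; rewrite Rmult_1_l in L.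
    apply L.
    + intros x Hx; exact (proj2 (Hg x Hx)).
    + assert (H := proj2 (Df (g s) Hgs)); lra.
Qed.

(** The function [q] is the cosine of the angle between the surface normal and
    the axis. It is obtained on a two-sided neighbourhood of [0] so that no
    boundary derivative has to be treated. *)
Lemma angle_function_exists (lambda : R) :
  -1 < lambda ->
  exists (R1 : R) (q : R -> R), 0 < R1 /\ q 0 = 1 /\
    forall r, - R1 < r < R1 ->
      0 < q r /\ (0 < r -> q r < 1) /\
      is_derive q r (- (r * (q r + lambda) / q r)).
Proof.
  intros Hl.
  set (a := Rmin (1 / 2) ((1 + lambda) / 2)).
  assert (Ha : 0 < a) by (apply Rmin_pos; lra).
  assert (Ha1 := Rmin_l (1 / 2) ((1 + lambda) / 2) : a <= _).
  assert (Ha2 := Rmin_r (1 / 2) ((1 + lambda) / 2) : a <= _).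
  destruct (local_inverse
    (fun t => t + lambda * ln (1 + lambda - t) - lambda * ln (1 + lambda))
    (fun t => (1 - t) / (1 + lambda - t)) a Ha) as [eta [g [Heta [g0 Hg]]]].
  - rewrite Rminus_0_r; ring.
  - intros t Ht; split.
    + auto_derive; [lra|field; lra].
    + apply Rdiv_lt_0_compat; lra.
  - cbv beta in Hg.
    assert (gpos : forall s, 0 < s < eta -> 0 < g s).
    { intros s Hs.
      destruct (MVT_cor2 g (fun c => / ((1 - g c) / (1 + lambda - g c))) 0 s)
        as [c [Hc Hcr]]; [lra| |].
      - intros c Hc; apply is_derive_Reals, Hg; lra.
      - destruct (Hg c ltac:(lra)) as [Hgc _].
        assert (0 < / ((1 - g c) / (1 + lambda - g c)) * (s - 0)); [|lra].
        apply Rmult_lt_0_compat; [|lra].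
        apply Rinv_0_lt_compat, Rdiv_lt_0_compat; lra. }
    assert (M1 := Rmin_l 1 eta); assert (M2 := Rmin_r 1 eta).
    assert (HM : 0 < Rmin 1 eta) by (apply Rmin_pos; lra).
    (* For [|r| < 1] one has [r ^ 2 / 2 <= |r|], so [r ^ 2 / 2 < eta]. *)
    exists (Rmin 1 eta), (fun r => 1 - g (r ^ 2 / 2)).
    split; [exact HM|split].
    + replace (0 ^ 2 / 2) with 0 by field; rewrite g0; ring.
    + intros r Hr.
      assert (Hs : 0 <= r ^ 2 / 2 < eta) by nra.
      destruct (Hg (r ^ 2 / 2) ltac:(lra)) as [Hgs Dg].
      split; [lra|split].
      * intros Hr0; assert (0 < g (r ^ 2 / 2)) by (apply gpos; nra); lra.
      * assert (Eg := is_derive_unique _ _ _ Dg).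
        auto_derive.
        -- replace (r * (r * 1) * / 2) with (r ^ 2 / 2) by field.
           eexists; exact Dg.
        -- replace (r * (r * 1) * / 2) with (r ^ 2 / 2) by field.
           change (Derive (fun x => g x)) with (Derive g); rewrite Eg.
           field; lra.
Qed.

(** The slope [p = sqrt (1 / q ^ 2 - 1)] solves [1 / sqrt (1 + p ^ 2) = q]. *)
Lemma solution_exists (lambda : R) :
  -1 < lambda ->
  exists R0 : R, 0 < R0 /\
    exists u : R -> R, is_solution lambda (Icc 0 R0) u.
Proof.
  intros Hl.
  destruct (angle_function_exists lambda Hl) as [R1 [q [HR1 [q0 Hq]]]].
  set (p := fun r => sqrt (/ (q r) ^ 2 - 1)).
  assert (Cq : forall r, - R1 < r < R1 -> continuous q r).
  { intros r Hr; apply (ex_derive_continuous q); eexists; apply (Hq r Hr). }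
  assert (Cp : forall r, - R1 < r < R1 -> continuous p r).
  { intros r Hr; unfold p.
    apply (continuous_comp (fun r => / (q r) ^ 2 - 1) sqrt);
      [|apply continuous_sqrt].
    apply (continuous_comp q (fun y => / y ^ 2 - 1)); [exact (Cq r Hr)|].
    apply (ex_derive_continuous (fun y => / y ^ 2 - 1)).
    assert (H := proj1 (Hq r Hr)).
    auto_derive; apply Rgt_not_eq; nra. }
  assert (p0 : p 0 = 0).
  { unfold p; rewrite q0; replace (/ 1 ^ 2 - 1) with 0 by field.
    apply sqrt_0. }
  assert (Hinv : forall r, 0 <= r < R1 -> 0 <= / (q r) ^ 2 - 1 /\
                             (0 < r -> 0 < / (q r) ^ 2 - 1)).
  { intros r Hr; destruct (Hq r ltac:(lra)) as [H1 [H2 _]].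
    assert (P : 0 < r -> 0 < / (q r) ^ 2 - 1).
    { intros Hr0; specialize (H2 Hr0).
      replace (/ (q r) ^ 2 - 1) with ((1 - q r) * (1 + q r) * / (q r) ^ 2)
        by (field; lra).
      apply Rmult_lt_0_compat; [nra|apply Rinv_0_lt_compat; nra]. }
    split; [|exact P].
    destruct (Req_dec r 0) as [->|nr].
    - rewrite q0; lra.
    - left; apply P; lra. }
  assert (Ep : forall r, 0 <= r < R1 -> 1 + p r ^ 2 = (/ q r) ^ 2).
  { intros r Hr; unfold p; rewrite pow2_sqrt by (apply Hinv, Hr).
    rewrite pow_inv; ring. }
  exists (R1 / 2); split; [lra|].
  exists (fun r => RInt p 0 r), p,
    (fun r => r * (q r + lambda) / ((q r) ^ 4 * p r)).
  unfold positive_part, Icc.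
  split; [|split; [|split; [|split; [exact (RInt_point 0 p)|exact p0]]]].
  - intros r Hr; split.
    + apply (D_in_of_is_derive _ _ (fun r => RInt p 0 r));
        [exact Hr|reflexivity|].
      apply is_derive_RInt with (a := 0); [|apply Cp; lra].
      assert (L := open_and (fun x => - R1 < x) (fun x => x < R1)
        (open_gt (- R1)) (open_lt R1) r ltac:(lra)).
      revert L; apply filter_imp; intros x Hx.
      apply (RInt_correct p), (ex_RInt_continuous p); intros z Hz; apply Cp.
      revert Hz; unfold Rmin, Rmax; destruct (Rle_dec 0 x); lra.
    + apply continue_in_of_continuous, Cp; lra.
  - intros r [Hr Hr0].
    destruct (Hq r ltac:(lra)) as [H1 [_ Dq]].
    destruct (Hinv r ltac:(lra)) as [_ H3]; specialize (H3 Hr0).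
    assert (Hp : 0 < p r) by (apply sqrt_lt_R0, H3).
    split.
    + apply (D_in_of_is_derive _ _ p); [lra|reflexivity|].
      unfold p; assert (Eq := is_derive_unique _ _ _ Dq).
      auto_derive.
      * split; [eexists; exact Dq|split; [nra|]].
        split; [exact H3|exact I].
      * change (Derive (fun x => q x)) with (Derive q); rewrite Eq.
        change (sqrt (/ (q r * (q r * 1)) + - (1))) with (p r).
        fold (p r); field; lra.
    + apply continue_in_of_continuous.
      assert (Cqr := Cq r ltac:(lra)); assert (Cpr := Cp r ltac:(lra)).
      apply (continuous_mult (fun r => r * (q r + lambda))
               (fun r => / ((q r) ^ 4 * p r))).
      * apply (continuous_mult (fun r => r) (fun r => q r + lambda));
          [apply continuous_id|].
        apply (continuous_plus q (fun _ => lambda));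
          [exact Cqr|apply continuous_const].
      * apply (continuous_comp (fun r => (q r) ^ 4 * p r) Rinv).
        -- apply (continuous_mult (fun r => (q r) ^ 4) p); [|exact Cpr].
           apply (continuous_comp q (fun y => y ^ 4)); [exact Cqr|].
           apply (ex_derive_continuous (fun y => y ^ 4)); auto_derive; exact I.
        -- apply continuous_Rinv.
           apply Rgt_not_eq, Rmult_lt_0_compat; [apply pow_lt, H1|exact Hp].
  - intros r [Hr Hr0].
    destruct (Hq r ltac:(lra)) as [H1 [_ Dq]].
    apply (D_in_of_is_derive _ _ (fun s => 1 - (q s) ^ 2)); [lra| |].
    + intros s [Hs _]; destruct (Hq s ltac:(lra)) as [H _].
      replace (p s ^ 2) with ((1 + p s ^ 2) - 1) at 1 by ring.
      rewrite (Ep s ltac:(lra)); field; lra.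
    + rewrite (Ep r ltac:(lra)), sqrt_pow2
        by (left; apply Rinv_0_lt_compat, H1).
      auto_derive; [eexists; exact Dq|].
      change (Derive (fun x => q x)) with (Derive q).
      rewrite (is_derive_unique _ _ _ Dq); field; lra.
Qed.

Theorem theorem3p3 (lambda : R) :
  (lambda < -1 ->
     forall delta : R, 0 < delta ->
       ~ (exists u : R -> R, is_solution lambda (Ico 0 delta) u)) /\
  (lambda = -1 ->
     forall delta : R, 0 < delta ->
       forall u : R -> R,
         is_solution lambda (Ico 0 delta) u <->
         (forall r : R, Ico 0 delta r -> u r = 0)) /\
  (-1 < lambda ->
     exists R0 : R, 0 < R0 /\
       exists u : R -> R, is_solution lambda (Icc 0 R0) u).
Proof.
  split; [|split].
  - intros Hl delta Hd [u Hu]; exact (no_solution lambda delta u Hl Hd Hu).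
  - intros -> delta Hd u; split.
    + exact (solution_zero delta u).
    + exact (zero_is_solution delta u Hd).
  - exact (solution_exists lambda).
Qed.
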